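(* Let $0<p<1$, let $\{X_n,\ n\ge1\}$ be the steps of the elephant random walk that remembers only the two most recent steps, with $P(X_1=1)=p=1-P(X_1=-1)$, let $S_n=\sum_{k=1}^n X_k$, and let $$\sigma_2^2=1+\frac{(2p-1)(5-2p)}{2(1-p)(3-2p)},\qquad \sigma_2>0.$$ Then, as $n\to\infty$, $\dfrac{S_n}{n}\to0$ almost surely and $\dfrac{S_n}{\sigma_2\sqrt n}$ converges in distribution to the standard normal law.
   Context: Elephant random walk remembering only the two most recent steps: $X_2=X_1$ with probability $p$ and $X_2=-X_1$ with probability $1-p$; for every $n\ge2$, choose $K$ uniformly on $\{n-1,n\}$ and set $X_{n+1}=X_K$ with probability $p$ and $X_{n+1}=-X_K$ with probability $1-p$. All index choices and sign choices are mutually independent and independent of $X_1$. *)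

(* Defs.v *)
From HB Require Import structures.
From mathcomp Require Import all_boot all_order all_algebra finmap.
From mathcomp Require Import all_classical all_reals all_analysis measurable_realfun.
Import Order.TTheory GRing.Theory Num.Theory.
Import numFieldNormedType.Exports.

Set Implicit Arguments.
Unset Strict Implicit.
Unset Printing Implicit Defensive.

Local Open Scope classical_set_scope.
Local Open Scope ring_scope.

Section independence.
Context d (T : measurableType d) (R : realType) (P : probability T R).

Definition mutually_independent (I : choiceType) (F : I -> set_system T) :=
  forall (J : {fset I}) (A : I -> set T), (forall i, i \in J -> F i (A i)) ->
    P (\bigcap_(i in [set` J]) A i) = (\prod_(i <- J) P (A i))%E.

Definition generated_sigma d' (T' : measurableType d') (Y : {RV P >-> T'})
    : set_system T :=
  preimage_set_system [set: T] Y measurable.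

(* Convergence of the distribution functions at every continuity point of the
   limiting one. *)
Definition cvg_in_distribution (Y : nat -> {RV P >-> R})
    (nu : probability (measurableTypeR R) R) :=
  forall x : R, {for x, continuous (fun y : R => nu `]-oo, y]%classic)} ->
    cdf (Y n) x @[n --> \oo] --> nu `]-oo, x]%classic.

End independence.

Arguments cvg_in_distribution {d T R} P Y nu.

Section elephant.
Context d (T : measurableType d) (R : realType) (P : probability T R).
Implicit Types (X eps : nat -> {RV P >-> R}) (K : nat -> {RV P >-> nat}).

(* Only [K n] for [n >= 2] and [eps n] for [n >= 1] enter the dynamics, whence
   the shifts. *)
Definition elephant_sources X K eps (i : unit + (nat + nat)) : set_system T :=
  match i with
  | inl _ => generated_sigma (X 1%N)
  | inr (inl n) => generated_sigma (K n.+2)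
  | inr (inr n) => generated_sigma (eps n.+1)
  end.

(* The steps are [X 1], [X 2], ...; the value [X 0] is irrelevant.  [K n] is the
   index recalled, and [eps n] the sign applied, when [X n.+1] is formed. *)
Record elephant_two_recent (p : R) X K eps : Prop := ElephantTwoRecent {
  index_choice : forall n, (2 <= n)%N ->
    P [set w | K n w = n.-1] = (2^-1)%:E /\ P [set w | K n w = n] = (2^-1)%:E ;
  sign_choice : forall n, (1 <= n)%N ->
    P [set w | eps n w = 1] = p%:E /\ P [set w | eps n w = -1] = (1 - p)%:E ;
  second_step : forall w, X 2%N w = eps 1%N w * X 1%N w ;
  next_step : forall n, (2 <= n)%N ->
    forall w, X n.+1 w = eps n w * X (K n w) w ;
  choices_independent : mutually_independent P (elephant_sources X K eps)
}.

Definition walk X (n : nat) (w : T) : R := \sum_(1 <= k < n.+1) X k w.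

Lemma measurable_walk X n : measurable_fun [set: T] (walk X n).
Proof. by apply: measurable_sum => k; exact: measurable_funP. Qed.

Definition normalized_walk X (sigma : R) (n : nat) (w : T) : R :=
  walk X n w / (sigma * Num.sqrt n%:R).

Lemma measurable_normalized_walk X sigma n :
  measurable_fun [set: T] (normalized_walk X sigma n).
Proof. by apply: measurable_funM => //; exact: measurable_walk. Qed.

HB.instance Definition _ X sigma n :=
  isMeasurableFun.Build _ _ _ _ (normalized_walk X sigma n)
    (measurable_normalized_walk X sigma n).

End elephant.

Arguments elephant_two_recent {d T R} P p X K eps.

(* Main.v *)
Require Import Defs.
From HB Require Import structures.
From mathcomp Require Import all_boot all_order all_algebra finmap.
From mathcomp Require Import all_classical all_reals all_analysis.
From mathcomp Require Import ring lra zify.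
Import Order.TTheory GRing.Theory Num.Theory.
Import numFieldNormedType.Exports.

Set Implicit Arguments.
Unset Strict Implicit.
Unset Printing Implicit Defensive.

Local Open Scope classical_set_scope.
Local Open Scope ring_scope.

(** With [m = (2 p - 1) / 2], the next step has conditional mean
    [m (X_n + X_{n-1})] given the past, so
    [M_n = (1 - 2 m) S_n + 2 m X_n + m X_{n-1}] is a martingale at bounded
    distance from [(1 - 2 m) S_n].

    Strong law: [E S_n^2 = O(n)], so Borel-Cantelli applies to the events
    [|S_{k^4}| > k^3], and bounded steps fill the gaps between fourth powers.

    Central limit theorem: Lindeberg's method with an explicit solution of the
    heat equation.  With [Phi] the normal distribution function, the function
    [G(v, x) = Phi((b - x) / sqrt v)] satisfies [G_v = G_xx / 2].  The
    conditional variance of a martingale increment is not constant, but it is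
    affine in [Y_n = X_n X_{n-1}], whose conditional mean is affine in
    [Y_{n-1}]; adding a multiple of [Y_n G_xx / n] to [G] therefore makes the
    one-step defect [O(n^(-3/2))].  Summing, [E G(delta^2, S_n / (sigma sqrt n))]
    converges to [G(1 + delta^2, 0) = Phi(b / sqrt (1 + delta^2))], and as
    [delta] tends to [0] the function [G(delta^2, .)] squeezes the indicator of
    [x <= b]. *)

(** * The law of the steps as weights on sign paths *)

Section sign_paths.
Context (R : realFieldType) (m : R).
Implicit Types (h : seq R) (f g : seq R -> R).

Fixpoint sign_paths n : seq (seq R) :=
  if n is n'.+1 then
    [seq 1 :: h | h <- sign_paths n'] ++ [seq -1 :: h | h <- sign_paths n']
  else [:: [::]].

(* Before the second step the walk behaves as if the older of the two recalled
   steps repeated the newer one, and as if [X_0 = 1]. *)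
Definition drift h : R :=
  match h with
  | [::] => 2 * m
  | [:: x] => 2 * m * x
  | x :: y :: _ => m * (x + y)
  end.

(** Paths carry the newest step at the head. Given the past [h'], the next step equals [x] with
    probability [(1 + x * drift h') / 2]; for the empty past this is the law of the first step when
    [m = (2 p - 1) / 2]. *)
Fixpoint path_weight h : R :=
  if h is x :: h' then path_weight h' * ((1 + x * drift h') / 2) else 1.

Definition path_expect n f := \sum_(h <- sign_paths n) path_weight h * f h.

Definition step_mean f h : R :=
  (1 + drift h) / 2 * f (1 :: h) + (1 - drift h) / 2 * f (-1 :: h).

(** Tower property: [step_mean f] is the conditional mean of [f] one step later, so the newest step
    is integrated out first. *)
Lemma path_expectS n f : path_expect n.+1 f = path_expect n (step_mean f).
Proof.
rewrite /path_expect /= big_cat /= !big_map -big_split /=.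
apply: eq_bigr => h _; rewrite /step_mean /=; ring.
Qed.

Lemma path_expectD n f g :
  path_expect n (fun h => f h + g h) = path_expect n f + path_expect n g.
Proof. by rewrite -big_split; apply: eq_bigr => h _; rewrite mulrDr. Qed.

Lemma path_expectN n f :
  path_expect n (fun h => - f h) = - path_expect n f.
Proof. by rewrite -sumrN; apply: eq_bigr => h _; rewrite mulrN. Qed.

Lemma path_expectZ n c f :
  path_expect n (fun h => c * f h) = c * path_expect n f.
Proof. by rewrite mulr_sumr; apply: eq_bigr => h _; rewrite mulrCA. Qed.

Lemma path_expect_cst n c : path_expect n (fun=> c) = c.
Proof.
elim: n => [|n IH]; first by rewrite /path_expect big_seq1 mul1r.
rewrite path_expectS -[RHS]IH; apply: eq_bigr => h _.
rewrite /step_mean; congr (_ * _); lra.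
Qed.

Lemma sign_pathsS x h n : (x :: h \in sign_paths n.+1) =
  ((x == 1) || (x == -1)) && (h \in sign_paths n).
Proof.
rewrite /= mem_cat; apply/orP/andP => [[]/mapP[h' h'n [-> ->]]|[/orP[]/eqP-> hn]].
- by rewrite eqxx.
- by rewrite eqxx orbT.
- by left; apply/map_f.
- by right; apply/map_f.
Qed.

Lemma sign_paths_size n h : h \in sign_paths n -> size h = n.
Proof.
elim: n h => [|n IH] [|x h]; rewrite ?inE//=.
- by rewrite mem_cat => /orP[]/mapP[].
- by move=> hn; have := sign_pathsS x h n; rewrite hn => /esym/andP[_ /IH ->].
Qed.

Hypothesis m_bound : `|m| <= 1 / 2.

(** This puts both transition probabilities in [[0, 1]], which makes [path_expect] a positive
    functional of total mass one. *)
Lemma drift_bound n h : h \in sign_paths n -> `|drift h| <= 1.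
Proof.
move: m_bound; rewrite !ler_norml => /andP[? ?] hn; have hs := sign_paths_size hn.
move: hs hn.
case: n h => [|[|n]] [|x [|y h]] // _; first by move=> _; apply/andP => /=; lra.
- by rewrite sign_pathsS => /andP[/orP[]/eqP-> _]; apply/andP => /=; lra.
- rewrite !sign_pathsS => /and3P[/orP[]/eqP-> /orP[]/eqP-> _].
  all: by apply/andP => /=; lra.
Qed.

Lemma path_weight_ge0 n h : h \in sign_paths n -> 0 <= path_weight h.
Proof.
elim: n h => [|n IH] [|x h] //=.
rewrite sign_pathsS => /andP[x1 hn]; apply: mulr_ge0; first exact: IH.
by have := drift_bound hn; rewrite ler_norml => /andP[? ?]; case/orP: x1 => /eqP->; lra.
Qed.

Lemma le_path_expect n f g : {in sign_paths n, forall h, f h <= g h} ->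
  path_expect n f <= path_expect n g.
Proof.
move=> fg; rewrite /path_expect !big_seq; apply: ler_sum => h hn.
by rewrite ler_wpM2l ?(path_weight_ge0 hn)// fg.
Qed.

Lemma eq_path_expect n f g : {in sign_paths n, f =1 g} ->
  path_expect n f = path_expect n g.
Proof. by move=> fg; apply: eq_big_seq => h hn; rewrite fg. Qed.

Lemma path_expect_dist n f g e :
  {in sign_paths n, forall h, `|f h - g h| <= e} ->
  `|path_expect n f - path_expect n g| <= e.
Proof.
move=> fg; rewrite -path_expectN -path_expectD ler_norml.
rewrite -{1}(path_expect_cst n (- e)) -{2}(path_expect_cst n e).
by apply/andP; split; apply: le_path_expect => h /fg; rewrite ler_norml => /andP[].
Qed.

(* The step compensated by its drift: for [n >= 2] the increments of
   [compensated] are [X_{n+1} - m (X_n + X_{n-1})]. *)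
Definition compensated h : R :=
  (1 - 2 * m) * (\sum_(x <- h) x) + 2 * m * nth 0 h 0 + m * nth 0 h 1.

Lemma compensatedS x y z h :
  compensated [:: x, y, z & h] = compensated [:: y, z & h] + (x - m * (y + z)).
Proof. rewrite /compensated !big_cons /=; ring. Qed.

Lemma sign_paths2P n h : h \in sign_paths n.+2 -> exists x y h',
  [/\ h = [:: x, y & h'], (x == 1) || (x == -1), (y == 1) || (y == -1) &
      h' \in sign_paths n].
Proof.
case: h => [|x [|y h']] hn; try by have := sign_paths_size hn.
by move: hn; rewrite !sign_pathsS => /and3P[? ? ?]; exists x, y, h'.
Qed.

Lemma compensated_bound h : h \in sign_paths 2 -> `|compensated h| <= 6.
Proof.
move=> /sign_paths2P[x [y [h' [-> x1 y1]]]]; rewrite inE => /eqP->.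
rewrite /compensated !big_cons big_nil /=; move: m_bound; rewrite !ler_norml.
by move=> /andP[? ?]; case/orP: x1 => /eqP->; case/orP: y1 => /eqP->;
  apply/andP; lra.
Qed.

(** Martingale increments are centred, so each step adds its conditional variance [1 - d ^ 2 <= 1]
    to the second moment. The start [36] is the square of the bound on paths of length two. *)
Lemma path_expect_compensated_sqr n :
  path_expect n.+2 (fun h => compensated h ^+ 2) <= 36 + n%:R.
Proof.
elim: n => [|n IH].
  rewrite addr0 -[leRHS](path_expect_cst 2) le_path_expect// => h /compensated_bound.
  by rewrite ler_norml => /andP[? ?]; nra.
rewrite path_expectS -[n.+1%:R]natr1 addrA.
apply: le_trans (lerD IH (lexx 1)).
rewrite -[X in _ <= _ + X](path_expect_cst n.+2 1) -path_expectD.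
apply: le_path_expect => h.
move=> /sign_paths2P[x [y [h' [-> _ _ _]]]]; rewrite /step_mean !compensatedS /=.
set M := compensated _; set d := m * (x + y).
have -> : (1 + d) / 2 * (M + (1 - d)) ^+ 2 + (1 - d) / 2 * (M + (-1 - d)) ^+ 2
  = M ^+ 2 + 1 - d ^+ 2 by field.
by have := sqr_ge0 d; lra.
Qed.

(** [(1 - 2 m) S] differs from the martingale by [b = 2 m x + m y] with [b ^ 2 <= 9 / 4], so its
    second moment is controlled by that of [compensated]. Length one, below the range of the
    martingale bound, is checked directly. *)
Lemma path_expect_sum_sqr n : m < 1 / 2 ->
  path_expect n.+1 (fun h => (\sum_(x <- h) x) ^+ 2) <=
  80 / (1 - 2 * m) ^+ 2 * n.+1%:R.
Proof.
move=> m_lt; have m2 : 0 < (1 - 2 * m) ^+ 2 by rewrite exprn_gt0//; lra.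
have m2le : (1 - 2 * m) ^+ 2 <= 4.
  by move: m_bound; rewrite ler_norml => /andP[? ?]; nra.
rewrite mulrAC ler_pdivlMr// mulrC -path_expectZ.
case: n => [|n].
  rewrite -[leRHS](path_expect_cst 1) le_path_expect// => -[|x [|y h]];
    try by move/sign_paths_size.
  rewrite sign_pathsS big_seq1 => /andP[/orP[]/eqP-> _]; lra.
apply: (@le_trans _ _ (2 * (36 + n%:R) + 5)); last first.
  by rewrite -[n.+2%:R]natr1 -[n.+1%:R]natr1; have : 0 <= n%:R :> R by []; lra.
apply: le_trans (lerD (ler_wpM2l _ (path_expect_compensated_sqr n)) (lexx 5)) => //.
rewrite -path_expectZ -[X in _ <= _ + X](path_expect_cst n.+2 5) -path_expectD.
apply: le_path_expect => h /sign_paths2P[x [y [h' [-> x1 y1 _]]]].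
rewrite /compensated /= -exprMn; set A := _ * \sum_(i <- _) i.
have B : (2 * m * x + m * y) ^+ 2 <= 9 / 4.
  move: m_bound; rewrite ler_norml => /andP[? ?].
  by case/orP: x1 => /eqP->; case/orP: y1 => /eqP->; nra.
rewrite -addrA; set b := 2 * m * x + _ in B *.
(* This square is exactly [2 (A + b) ^ 2 + 2 b ^ 2 - A ^ 2]; the added constant [5] absorbs
   [2 b ^ 2 <= 9 / 2]. *)
by have := sqr_ge0 (A + 2 * b); lra.
Qed.

End sign_paths.

(** * Lindeberg comparison with a heat flow *)

Section heat_comparison.
Context (R : realFieldType) (m : R).
Hypotheses (m_gt : - (1 / 2) < m) (m_lt : m < 1 / 2).
(** [G1] and [H] stand for the first and second space derivatives of the heat flow [G]. All
    estimates hold for times at least [v0], which keeps away from the singularity at time zero. *)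
Context (G G1 H : R -> R -> R) (v0 C : R).
Hypothesis C_ge0 : 0 <= C.
Hypothesis G_taylor : forall v x a, v0 <= v ->
  `|G v (x + a) - G v x - a * G1 v x - a ^+ 2 / 2 * H v x| <= C * `|a| ^+ 3.
Hypothesis G_heat : forall v x (s : R), v0 <= v -> 0 <= s ->
  `|G (v + s) x - G v x - s / 2 * H v x| <= C * s ^+ 2.
Hypothesis G_lip : forall v x a, v0 <= v -> `|G v (x + a) - G v x| <= C * `|a|.
Hypothesis H_bound : forall v x, v0 <= v -> `|H v x| <= C.
Hypothesis H_lip : forall v x a, v0 <= v -> `|H v (x + a) - H v x| <= C * `|a|.
Hypothesis H_time : forall v x (s : R), v0 <= v -> 0 <= s ->
  `|H (v + s) x - H v x| <= C * s.

Let m_bound : `|m| <= 1 / 2.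
Proof. by rewrite ler_norml; apply/andP; split; exact: ltW. Qed.

(** Long-run variance of a martingale increment. The conditional variance is [1 - 2 m ^ 2 (1 + Y)]
    with [Y] the product of the last two steps; since the conditional mean of the next [Y] is
    [m (1 + Y)], the stationary mean of [Y] is [m / (1 - m)]. *)
Definition limit_variance : R := (1 + m) * (1 - 2 * m) / (1 - m).
Notation tau2 := limit_variance.

Lemma limit_variance_gt0 : 0 < tau2.
Proof. by rewrite /tau2 divr_gt0 ?mulr_gt0//; move: m_gt m_lt; lra. Qed.

Let tau2_le6 : tau2 <= 6.
Proof.
move: m_gt m_lt => mgt mlt; rewrite /tau2 ler_pdivrMr; last by lra.
by have := sqr_ge0 m; nra.
Qed.

(** The solution of [k - m k = m ^ 2], which cancels the [Y]-dependent part of the one-step defect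
    at order [e ^ 2]; the constant part then equals half of [tau2]. *)
Let k := m ^+ 2 / (1 - m).

Let k_ge0 : 0 <= k.
Proof. by rewrite divr_ge0 ?sqr_ge0//; move: m_lt; lra. Qed.

Let k_le : k <= 1 / 2.
Proof.
by move: m_gt m_lt => mgt mlt; rewrite ler_pdivrMr; [nra|lra].
Qed.

(* The second term absorbs the fluctuation of the conditional variance, which
   depends on the path through the product of the last two steps. *)
Definition corrected (v e : R) h : R :=
  G v (e * compensated m h)
  - e ^+ 2 * k * (nth 0 h 0 * nth 0 h 1) * H v (e * compensated m h).

(** One step of the walk at scale [e] matches heat time [e ^ 2 * tau2]: the first order vanishes
    because the increment is centred, the second by the choice of [k] and [tau2]. *)
Lemma step_corrected n (v e : R) h : v0 <= v -> 0 < e -> e <= 1 ->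
  h \in sign_paths R n.+2 ->
  `|step_mean m (corrected v e) h - corrected (v + e ^+ 2 * tau2) e h|
    <= 48 * C * e ^+ 3.
Proof.
move=> v0v e0 e1 hn; have := drift_bound m_bound hn.
move: hn => /sign_paths2P[x [y [h' [-> x1 y1 _]]]].
rewrite /step_mean /corrected !compensatedS /=.
set M := compensated _ _; set d := m * (x + y) => d1.
have tau0 := limit_variance_gt0.
have s0 : 0 <= e ^+ 2 * tau2 by rewrite mulr_ge0 ?sqr_ge0// ltW.
have s6 : e ^+ 2 * tau2 <= 6 * e ^+ 2 by rewrite mulrC ler_wpM2r ?sqr_ge0.
have e2 : e ^+ 2 <= e by rewrite expr2 ler_piMl// ltW.
rewrite (mulrDr e M (1 + _)) (mulrDr e M (-1 + _)).
set u := e * M; set a := e * (1 + - d); set b := e * (-1 + - d).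
have [/andP[d_ge d_le]] : -1 <= d <= 1 by rewrite -ler_norml.
have a_le : `|a| <= 2 * e.
  by rewrite ler_norml; apply/andP; rewrite /a; split; nra.
have b_le : `|b| <= 2 * e.
  by rewrite ler_norml; apply/andP; rewrite /b; split; nra.
have cube (z : R) : `|z| <= 2 * e -> C * `|z| ^+ 3 <= 8 * C * e ^+ 3.
  move=> ze; have -> : 8 * C * e ^+ 3 = C * (2 * e) ^+ 3 by ring.
  by rewrite ler_wpM2l// lerXn2r// nnegrE ?mulr_ge0// ltW.
have lin (z : R) : `|z| <= 2 * e -> C * `|z| <= 2 * C * e.
  by move=> ze; rewrite -mulrA mulrCA ler_wpM2l.
have := le_trans (G_taylor u a v0v) (cube _ a_le).
have := le_trans (G_taylor u b v0v) (cube _ b_le).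
have := le_trans (H_lip u a v0v) (lin _ a_le).
have := le_trans (H_lip u b v0v) (lin _ b_le).
have := G_heat u v0v s0.
have := H_time u v0v s0.
set g := G v u; set g1 := G1 v u; set h0 := H v u.
set rt := H _ u - h0; set gt := G _ u - g - _; set rb := H v _ - h0.
set ra := H v _ - h0; set gb := G v _ - g - _ - _; set ga := G v _ - g - _ - _.
move=> rt_le gt_le rb_le ra_le gb_le ga_le.
(* The exact cancellation: every term in [g], [g1] and [h0] drops out, and only Taylor, heat and
   Lipschitz remainders are left. *)
have -> : (1 + d) / 2 * (G v (u + a) - e ^+ 2 * k * (1 * x) * H v (u + a)) +
  (1 - d) / 2 * (G v (u + b) - e ^+ 2 * k * (-1 * x) * H v (u + b)) -
  (G (v + e ^+ 2 * tau2) u - e ^+ 2 * k * (x * y) * H (v + e ^+ 2 * tau2) u)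
  = (1 + d) / 2 * ga + (1 - d) / 2 * gb - gt
   - e ^+ 2 * k * ((1 + d) / 2 * x * ra - (1 - d) / 2 * x * rb - x * y * rt).
  have m1 : 1 - m != 0 by move: m_lt => mlt; rewrite gt_eqF//; lra.
  rewrite /ga /gb /gt /ra /rb /rt /a /b /tau2 /k /d.
  by case/orP: x1 => /eqP->; case/orP: y1 => /eqP->; field.
have qa : 0 <= (1 + d) / 2 <= 1 by apply/andP; split; lra.
have qb : 0 <= (1 - d) / 2 <= 1 by apply/andP; split; lra.
have mean (z w c : R) : `|z| <= c -> `|w| <= c ->
    `|(1 + d) / 2 * z + (1 - d) / 2 * w| <= c.
  rewrite !ler_norml => /andP[z1 z2] /andP[w1 w2].
  by move: qa qb => /andP[? _] /andP[? _]; apply/andP; split; nra.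
have sign_norm (s z : R) : (s == 1) || (s == -1) -> `|s * z| = `|z|.
  by case/orP => /eqP->; rewrite ?mul1r ?mulN1r ?normrN.
have main := mean _ _ _ ga_le gb_le.
have : `|(1 + d) / 2 * x * ra - (1 - d) / 2 * x * rb - x * y * rt| <= 8 * C * e.
  have -> : (1 + d) / 2 * x * ra - (1 - d) / 2 * x * rb =
    (1 + d) / 2 * (x * ra) + (1 - d) / 2 * - (x * rb) by ring.
  have -> : 8 * C * e = 2 * C * e + C * (6 * e) by ring.
  apply: le_trans (ler_normB _ _) _; apply: lerD.
    by apply: mean; rewrite ?normrN sign_norm.
  by rewrite -mulrA !sign_norm//; apply: le_trans rt_le _; rewrite ler_wpM2l//; lra.
set rest := _ - x * y * rt => rest_le.
apply: le_trans (ler_normB _ _) _; apply: le_trans (lerD (ler_normB _ _) (lexx _)) _.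
(* The three shares are the Taylor remainders with increments at most [2 e], the heat remainder with
   time at most [6 e ^ 2 <= 6 e], and the variation of the correction with [k <= 1 / 2]. *)
have -> : 48 * C * e ^+ 3 = 8 * C * e ^+ 3 + C * (6 * e ^+ 2 * (6 * e))
  + e ^+ 2 * (1 / 2) * (8 * C * e) by field.
apply: lerD; first apply: lerD => //.
  apply: le_trans gt_le _; rewrite ler_wpM2l// [leLHS]expr2 ler_pM//; lra.
have K0 : 0 <= e ^+ 2 * k by apply: mulr_ge0 => //; exact: sqr_ge0.
rewrite normrM (ger0_norm K0).
by apply: ler_pM => //; rewrite ler_wpM2l ?sqr_ge0.
Qed.

(** Backward recursion: integrating out the newest step trades it for [e ^ 2 * tau2] of heat time,
    and the one-step errors add up. *)
Lemma path_expect_corrected n (v e : R) : v0 <= v -> 0 < e -> e <= 1 ->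
  `|path_expect m n.+2 (corrected v e)
    - path_expect m 2 (corrected (v + n%:R * (e ^+ 2 * tau2)) e)|
  <= n%:R * (48 * C * e ^+ 3).
Proof.
move=> + e0 e1; elim: n v => [|n IH] v v0v.
  by rewrite !mul0r addr0 subrr normr0.
have s0 : 0 <= e ^+ 2 * tau2 by rewrite mulr_ge0 ?sqr_ge0// ltW// limit_variance_gt0.
have v1 : v0 <= v + e ^+ 2 * tau2 by lra.
have := IH _ v1; rewrite (@path_expectS _ _ n.+2).
have := path_expect_dist m_bound (fun h => @step_corrected n v e h v0v e0 e1).
have -> : v + n.+1%:R * (e ^+ 2 * tau2) =
  v + e ^+ 2 * tau2 + n%:R * (e ^+ 2 * tau2) by rewrite -natr1; ring.
move=> b1 b2; rewrite -natr1 mulrDl mul1r [leRHS]addrC.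
by apply: le_trans (ler_distD _ _ _) (lerD b1 b2).
Qed.

(** The normalization of [e] makes the total heat time one. With about [1 / (e ^ 2 tau2)] steps,
    one-step errors of order [e ^ 3] sum to order [e], which gives [48 / tau2]; the two ends of the
    recursion cost [3 + 157 = 160]. *)
Lemma path_expect_heat n (e : R) : 0 < e -> e <= 1 ->
  n.+2%:R * (e ^+ 2 * tau2) = 1 ->
  `|path_expect m n.+2 (fun h => G v0 (e * (1 - 2 * m) * (\sum_(x <- h) x)))
    - G (v0 + 1) 0| <= C * (160 + 48 / tau2) * e.
Proof.
move=> e0 e1 ne; set s := e ^+ 2 * tau2 in ne *.
have tau0 := limit_variance_gt0.
have s0 : 0 <= s by rewrite mulr_ge0 ?sqr_ge0// ltW.
have e2 : e ^+ 2 <= e by rewrite expr2 ler_piMl// ltW.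
have s6 : s <= 6 * e.
  apply: le_trans (_ : 6 * e ^+ 2 <= _); last by lra.
  by rewrite /s mulrC ler_wpM2r ?sqr_ge0.
have Ce : 0 <= C * e by rewrite mulr_ge0// ltW.
set v := v0 + n%:R * s.
have v0v : v0 <= v by rewrite lerDl mulr_ge0.
have vE : v0 + 1 = v + 2 * s.
  by rewrite -[X in v0 + X]ne -[n.+2%:R]natr1 -[n.+1%:R]natr1 /v; ring.
have term_le n' h v' : v0 <= v' -> h \in sign_paths R n'.+2 ->
  `|e ^+ 2 * k * (nth 0 h 0 * nth 0 h 1) * H v' (e * compensated m h)| <= C * e.
  move=> v0v' /sign_paths2P[x [y [h' [-> x1 y1 _]]]] /=.
  have xy : `|x * y| = 1.
    by rewrite normrM; case/orP: x1 => /eqP->; case/orP: y1 => /eqP->;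
      rewrite ?normrN normr1 mulr1.
  have K0 : 0 <= e ^+ 2 * k by apply: mulr_ge0 => //; exact: sqr_ge0.
  rewrite normrM (normrM (e ^+ 2 * k)) xy mulr1 (ger0_norm K0) mulrC.
  apply: ler_pM => //; first exact: H_bound.
  apply: le_trans (_ : e ^+ 2 * (1 / 2) <= _); first by rewrite ler_wpM2l ?sqr_ge0.
  by lra.
(* One unit pays for the correction term, two for replacing the martingale by [(1 - 2 m) S]. *)
have b1 : `|path_expect m n.+2 (fun h => G v0 (e * (1 - 2 * m) * (\sum_(x <- h) x)))
    - path_expect m n.+2 (corrected v0 e)| <= 3 * (C * e).
  apply: path_expect_dist => // h hn; rewrite /corrected opprB addrCA.
  have -> : 3 * (C * e) = C * e + C * (2 * e) by ring.
  apply: le_trans (ler_normD _ _) (lerD _ _); first exact: term_le hn.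
  move: hn => /sign_paths2P[x [y [h' [-> x1 y1 _]]]].
  have -> : e * compensated m [:: x, y & h'] =
    e * (1 - 2 * m) * (\sum_(i <- [:: x, y & h']) i) + e * (2 * m * x + m * y).
    by rewrite /compensated /=; ring.
  rewrite distrC; apply: le_trans (G_lip _ _ (lexx _)) _; rewrite ler_wpM2l//.
  rewrite normrM ger0_norm ?(ltW e0)// mulrC ler_pM2r// ler_norml.
  move: m_gt m_lt => mgt mlt.
  by case/orP: x1 => /eqP->; case/orP: y1 => /eqP->; apply/andP; lra.
have b2 := @path_expect_corrected n v0 e (lexx _) e0 e1.
(* The recursion stops at two steps: the martingale is then at most [6], and heat time [2 s] is
   still missing from [v0 + 1]. *)
have b3 : `|path_expect m 2 (corrected v e) - G (v0 + 1) 0| <= 157 * (C * e).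
  rewrite -[G (v0 + 1) 0](path_expect_cst m 2); apply: path_expect_dist => // h hn.
  rewrite /corrected addrAC.
  have -> : 157 * (C * e) = (C * (6 * e) + (C * (12 * e * 12) + 6 * e * C)) + C * e
    by ring.
  apply: le_trans (ler_normB _ _) (lerD _ (term_le _ _ _ v0v hn)).
  rewrite -(subrKA (G v 0)) vE; apply: le_trans (ler_normD _ _) (lerD _ _).
    have := G_lip 0 (e * compensated m h) v0v; rewrite add0r => /le_trans; apply.
    rewrite ler_wpM2l// normrM ger0_norm ?(ltW e0)// mulrC ler_pM2r//.
    exact: compensated_bound hn.
  rewrite distrC; have s2 : 0 <= 2 * s by lra.
  have -> : G (v + 2 * s) 0 - G v 0 =
    (G (v + 2 * s) 0 - G v 0 - 2 * s / 2 * H v 0) + s * H v 0 by field.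
  apply: le_trans (ler_normD _ _) (lerD _ _).
    by apply: le_trans (G_heat _ v0v s2) _; rewrite ler_wpM2l//; nra.
  by rewrite normrM ger0_norm// ler_pM// H_bound.
have -> : C * (160 + 48 / tau2) * e = 3 * (C * e) + (48 / tau2 * (C * e) + 157 * (C * e))
  by ring.
apply: le_trans (ler_distD (path_expect m n.+2 (corrected v0 e)) _ _) (lerD b1 _).
apply: le_trans (ler_distD (path_expect m 2 (corrected v e)) _ _) (lerD _ b3).
apply: le_trans b2 _.
have -> : 48 / tau2 * (C * e) = n.+2%:R * (48 * C * e ^+ 3).
  have -> : n.+2%:R = (e ^+ 2 * tau2)^-1.
    by rewrite -[LHS](mulfK (_ : e ^+ 2 * tau2 != 0)) ?ne ?mul1r// mulf_neq0 ?gt_eqF// exprn_gt0.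
  by field; rewrite !gt_eqF.
have c0 : 0 <= 48 * C * e ^+ 3 by rewrite !mulr_ge0// ltW.
by apply: ler_wpM2r => //; rewrite ler_nat ltnW.
Qed.

End heat_comparison.

(** * The Gaussian solution of the heat equation *)

Section mean_value.
Context (R : realType).
Implicit Types (f df : R -> R) (x a b K : R).

Lemma le_mean_value f df a b K : a <= b ->
  (forall x, a <= x <= b -> is_derive x 1 f (df x)) ->
  (forall x, a <= x <= b -> `|df x| <= K) -> `|f b - f a| <= K * (b - a).
Proof.
move=> ab fE dfK.
have [||c] := @MVT_segment _ f df a b ab.
- by move=> x /andP[? ?]; apply: fE; rewrite !ltW.
- apply: continuous_in_subspaceT => x; rewrite inE/= in_itv/= => /fE fx.
  apply: differentiable_continuous; apply/derivable1_diffP.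
  exact: ex_derive.
rewrite in_itv/= => /dfK cK ->.
by rewrite normrM [X in _ * X <= _]ger0_norm ?subr_ge0// ler_wpM2r ?subr_ge0.
Qed.

Lemma le_mean_value_shift f df x a K :
  (forall t : R, is_derive t 1 f (df t)) ->
  (forall t, `|t - x| <= `|a| -> `|df t| <= K) ->
  `|f (x + a) - f x| <= K * `|a|.
Proof.
move=> fE dfK; have [a0|a0] := leP 0 a.
  rewrite (_ : `|a| = x + a - x); last by rewrite addrAC subrr add0r ger0_norm.
apply: (@le_mean_value _ df); first by rewrite lerDl.
  move=> t tx; apply: dfK; rewrite ler_norml.
  by rewrite ger0_norm//; move: tx => /andP[? ?]; apply/andP; lra.
rewrite (_ : `|a| = x - (x + a)); last by rewrite opprD addNKr ltr0_norm.
rewrite distrC; apply: (@le_mean_value _ df).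
- by rewrite gerDl ltW.
- move=> t tx; apply: dfK; rewrite ler_norml.
  by rewrite ltr0_norm//; move: tx => /andP[? ?]; apply/andP; lra.
Qed.

(** The mean value bound is used twice: on the first-order remainder [g1] of [f1], then on the
    second-order remainder [g] of [f], whose derivative is [g1]. The constant is not optimized. *)
Lemma le_taylor2 f (f1 f2 : R -> R) K x a : 0 <= K ->
  (forall t : R, is_derive t 1 f (f1 t)) -> (forall t : R, is_derive t 1 f1 (f2 t)) ->
  (forall y h, `|f2 (y + h) - f2 y| <= K * `|h|) ->
  `|f (x + a) - f x - a * f1 x - a ^+ 2 / 2 * f2 x| <= K * `|a| ^+ 3.
Proof.
move=> K0 fE f1E f2K.
pose g1 t := f1 t - f1 x - (t - x) * f2 x.
have g1E (t : R) : is_derive t 1 g1 (f2 t - f2 x).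
  have ? := f1E t.
  rewrite /g1; apply: is_derive_eq.
  rewrite /GRing.scale/=; ring.
have g1K (t : R) : `|t - x| <= `|a| -> `|g1 t| <= K * `|a| ^+ 2.
  move=> ta; have g1x : g1 x = 0 by rewrite /g1 !subrr mul0r subr0.
  have : `|g1 (x + (t - x)) - g1 x| <= K * `|a| * `|t - x|.
    apply: le_mean_value_shift => s sx.
    rewrite -(subrK x s) [_ + x]addrC; apply: le_trans (f2K _ _) _.
    by rewrite ler_wpM2l// (le_trans sx).
  rewrite g1x subr0 addrC subrK => /le_trans; apply.
  by rewrite expr2 mulrA ler_wpM2l// mulr_ge0.
pose g t := f t - f x - (t - x) * f1 x - (t - x) ^+ 2 / 2 * f2 x.
have gE (t : R) : is_derive t 1 g (g1 t).
  have ? := fE t.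
  rewrite /g /g1; apply: is_derive_eq.
  by rewrite /GRing.scale/=; field.
have := le_mean_value_shift gE g1K.
have -> : g x = 0 by rewrite /g !subrr expr0n/= !mul0r !subr0.
have -> : K * `|a| ^+ 3 = K * `|a| ^+ 2 * `|a| by ring.
by rewrite subr0 /g (_ : x + a - x = a)//; ring.
Qed.

End mean_value.

(** * The standard normal density and distribution function *)

Section gaussian.
Context (R : realType).
Implicit Types (x z : R).

Definition gauss_pdf z : R := normal_pdf 0 1 z.

Definition gauss_cdf z : R := \int[lebesgue_measure]_(t in `]-oo, z]) gauss_pdf t.

Notation peak := (normal_peak (1 : R)).

Lemma gauss_pdfE z : gauss_pdf z = peak * expR (- (z ^+ 2 / 2)).
Proof.
rewrite /gauss_pdf normal_pdfE ?oner_eq0// /normal_fun subr0 expr1n mulNr.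
by rewrite -mulr_natr mul1r.
Qed.

Lemma gauss_pdf_integrable (A : set R) : measurable A ->
  lebesgue_measure.-integrable A (EFin \o gauss_pdf).
Proof.
by move=> mA; apply: integrableS (integrable_normal_pdf 0 1).
Qed.

Lemma gauss_cdfE z : normal_prob 0 1 `]-oo, z]%classic = (gauss_cdf z)%:E.
Proof.
rewrite /gauss_cdf /Rintegral fineK//.
exact/integrable_fin_num/gauss_pdf_integrable.
Qed.

Lemma is_derive_gauss_cdf z : is_derive z 1 gauss_cdf (gauss_pdf z).
Proof.
have [||||] := @continuous_FTC1 R gauss_pdf -oo%O z (z + 1).
- by rewrite ltrDl.
- exact: gauss_pdf_integrable.
- by rewrite ltNyr.
- by apply: continuous_normal_pdf; rewrite oner_eq0.
- move=> dF <-; rewrite derive1E; exact: derivableP.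
Qed.

Lemma is_derive_gauss_pdf z : is_derive z 1 gauss_pdf (- (z * gauss_pdf z)).
Proof.
rewrite (_ : gauss_pdf = fun z => peak * expR (- (z ^+ 2 / 2))); last first.
  by apply/funext => y; rewrite gauss_pdfE.
by apply: is_derive_eq; rewrite /GRing.scale/=; field.
Qed.

Lemma gauss_cdf_ge0 z : 0 <= gauss_cdf z.
Proof. by rewrite -lee_fin -gauss_cdfE. Qed.

Lemma gauss_cdf_le1 z : gauss_cdf z <= 1.
Proof. by rewrite -lee_fin -gauss_cdfE probability_le1. Qed.

Lemma gauss_cdf_nondecreasing : {homo gauss_cdf : x y / x <= y}.
Proof.
move=> x y xy; rewrite -lee_fin -!gauss_cdfE le_measure ?inE//.
exact: subset_itvl.
Qed.

Lemma gauss_pdf_ge0 z : 0 <= gauss_pdf z. Proof. exact: normal_pdf_ge0. Qed.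

(** Seen as a random variable under the normal law, the identity has distribution function
    [gauss_cdf], which therefore inherits the limits of a [cdf] at both infinities. *)
Let idR : measurableTypeR R -> R := idfun.

#[local] HB.instance Definition _ :=
  @isMeasurableFun.Build _ _ _ _ idR (@measurable_id _ _ setT).

Let gauss_cdf_id : (fun x => (gauss_cdf x)%:E) =
  cdf (idR : {RV (normal_prob (0 : R) 1) >-> R}).
Proof.
by apply/funext => x; rewrite -gauss_cdfE /cdf /distribution /pushforward preimage_id.
Qed.

Lemma cvg_gauss_cdfNy : gauss_cdf x @[x --> -oo] --> (0 : R).
Proof.
have := @cvg_cdfNy0 _ _ _ _ (idR : {RV (normal_prob (0 : R) 1) >-> R}).
by rewrite -gauss_cdf_id => /fine_cvg.
Qed.

Lemma cvg_gauss_cdfy : gauss_cdf x @[x --> +oo] --> (1 : R).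
Proof.
have := @cvg_cdfy1 _ _ _ _ (idR : {RV (normal_prob (0 : R) 1) >-> R}).
by rewrite -gauss_cdf_id => /fine_cvg.
Qed.

(** The exponential is split into two equal factors [w], so that each can absorb part of the power
    of [z]: [1 + t <= expR t] gives [y * w <= 5 / 2] and [y ^ 2 * w <= 4], and the cubic case yields
    the factor [10]. *)
Lemma gauss_pdf_moments z (Q := 10 * peak) :
  gauss_pdf z <= Q /\ `|z| * gauss_pdf z <= Q /\
  z ^+ 2 * gauss_pdf z <= Q /\ `|z| ^+ 3 * gauss_pdf z <= Q.
Proof.
set w := expR (- (z ^+ 2 / 4)).
have wE : gauss_pdf z = peak * (w * w).
  by rewrite gauss_pdfE -expRD; congr (_ * expR _); field.
have w0 : 0 < w by exact: expR_gt0.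
have : (1 + z ^+ 2 / 4) * w <= 1.
  by rewrite /w expRN ler_pdivrMr ?expR_gt0// mul1r expR_ge1Dx.
have z2 : `|z| ^+ 2 = z ^+ 2 by rewrite real_normK ?num_real.
rewrite -z2 wE; set y := `|z|; have y0 : 0 <= y by exact: normr_ge0.
have c0 := @normal_peak_ge0 R 1; move=> yw.
have w1 : w <= 1 by nra.
have y2w : y ^+ 2 * w <= 4 by nra.
have y1w : y * w <= 5 / 2 by nra.
rewrite /Q (exprS y 2); split; [|split; [|split]]; rewrite ?[_ * (peak * _)]mulrCA mulrC.
all: rewrite ler_wpM2r//.
- by nra.
- rewrite mulrA; apply: (@le_trans _ _ (5 / 2 * 1)); last by lra.
  by apply: ler_pM => //; rewrite ?mulr_ge0// ltW.
- rewrite mulrA; apply: (@le_trans _ _ (4 * 1)); last by lra.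
  by apply: ler_pM => //; rewrite ?mulr_ge0 ?sqr_ge0// ltW.
- rewrite (_ : y * y ^+ 2 * (w * w) = y * w * (y ^+ 2 * w)); last by ring.
  apply: (@le_trans _ _ (5 / 2 * 4)); last by lra.
  by apply: ler_pM => //; rewrite ?mulr_ge0 ?sqr_ge0// ltW.
Qed.

End gaussian.

(** * The heat flow started from a half-line indicator, with uniform derivative bounds *)

Section heat.
Context (R : realType) (b : R).
Implicit Types (v x : R).

Let r v : R := (Num.sqrt v)^-1.
Let z v x := (b - x) * r v.

Let r_gt0 v : 0 < v -> 0 < r v.
Proof. by move=> v0; rewrite invr_gt0 sqrtr_gt0. Qed.

Let is_derive_r v : 0 < v -> is_derive v 1 r (- (r v ^+ 3 / 2)).
Proof.
move=> v0; have ? := is_derive1_sqrt v0.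
have s0 : Num.sqrt v != 0 by rewrite gt_eqF ?sqrtr_gt0.
apply: is_derive_eq; first exact: is_deriveV.
by rewrite /GRing.scale/= /r; field.
Qed.

Definition heat v x : R := gauss_cdf (z v x).
Definition heat1 v x : R := - (r v * gauss_pdf (z v x)).
Definition heat2 v x : R := - (r v ^+ 2 * (z v x * gauss_pdf (z v x))).

Let is_derive_z v x : is_derive x 1 (z v) (- r v).
Proof. by apply: is_derive_eq; rewrite /GRing.scale/=; ring. Qed.

Let is_derive_zv v x : 0 < v -> is_derive v 1 (z ^~ x) (- (z v x * r v ^+ 2 / 2)).
Proof.
move=> v0; have ? := is_derive_r v0.
apply: is_derive_eq; rewrite /GRing.scale/= /z; ring.
Qed.

Lemma is_derive_heat v x : is_derive x 1 (heat v) (heat1 v x).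
Proof.
have ? := is_derive_gauss_cdf (z v x); have ? := is_derive_z v x.
apply: is_derive_eq.
rewrite /heat1; ring.
Qed.

Lemma is_derive_heat1 v x : is_derive x 1 (heat1 v) (heat2 v x).
Proof.
have ? := is_derive1_comp (is_derive_gauss_pdf (z v x)) (is_derive_z v x).
have ? := is_derive_z v x.
apply: is_derive_eq.
rewrite /GRing.scale/= /heat2; ring.
Qed.

Definition heat3 v x : R := r v ^+ 3 * (1 - z v x ^+ 2) * gauss_pdf (z v x).
Definition heat2_time v x : R :=
  r v ^+ 4 * (z v x + z v x * (1 - z v x ^+ 2) / 2) * gauss_pdf (z v x).

Lemma is_derive_heat2 v x : is_derive x 1 (heat2 v) (heat3 v x).
Proof.
have ? := is_derive1_comp (is_derive_gauss_pdf (z v x)) (is_derive_z v x).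
have ? := is_derive_z v x.
apply: is_derive_eq.
rewrite /GRing.scale/= /heat3; ring.
Qed.

(** This is the heat equation, [heat2] being the second space derivative. *)
Lemma is_derive_heat_time v x : 0 < v ->
  is_derive v 1 (heat ^~ x) (heat2 v x / 2).
Proof.
move=> v0; have ? := is_derive_gauss_cdf (z v x); have ? := is_derive_zv x v0.
apply: is_derive_eq.
rewrite /heat2; ring.
Qed.

Lemma is_derive_heat2_time v x : 0 < v ->
  is_derive v 1 (heat2 ^~ x) (heat2_time v x).
Proof.
move=> v0; have ? := is_derive_zv x v0.
have ? := is_derive_r v0.
have ? := is_derive1_comp (f := @gauss_pdf R) (g := z ^~ x)
  (is_derive_gauss_pdf _) (is_derive_zv x v0).
apply: is_derive_eq.
by rewrite /GRing.scale/= /heat2_time; field.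
Qed.

Context (v0 : R).
Hypothesis v0_gt0 : 0 < v0.

Let rho := r v0.
Let Q := 10 * normal_peak (1 : R).

(** Each derivative in play is [r v ^ k] with [1 <= k <= 4], times a polynomial in [z] of degree at
    most three, times the density. Since [r v <= rho], one constant serves for all of them. *)
Definition heat_const : R := 3 * Q * (rho + rho ^+ 2 + rho ^+ 3 + rho ^+ 4).
Notation C := heat_const.

Let v_gt0 v : v0 <= v -> 0 < v. Proof. exact: lt_le_trans. Qed.

Let r_bound v k : v0 <= v -> `|r v ^+ k| <= rho ^+ k.
Proof.
move=> v0v; have r0 := r_gt0 (v_gt0 v0v).
rewrite ger0_norm ?exprn_ge0// ?(ltW r0)// lerXn2r ?nnegrE ?(ltW r0)//.
  exact/ltW/r_gt0.
by rewrite /rho /r lef_pV2 ?posrE ?sqrtr_gt0 ?(v_gt0 v0v)// ler_sqrt// ltW// v_gt0.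
Qed.

Let Q_ge0 : 0 <= Q. Proof. by rewrite mulr_ge0// normal_peak_ge0. Qed.
Let rho_ge0 k : 0 <= rho ^+ k. Proof. by rewrite exprn_ge0// ltW// r_gt0. Qed.

Lemma heat_const_ge0 : 0 <= C.
Proof.
have rho1 := rho_ge0 1; rewrite expr1 in rho1.
by apply: mulr_ge0; [exact: mulr_ge0|rewrite !addr_ge0].
Qed.

Let C_ge k c : (0 < k <= 4)%N -> c <= 3 -> rho ^+ k * (c * Q) <= C.
Proof.
move=> k4 c3; apply: (@le_trans _ _ (rho ^+ k * (3 * Q))).
  by rewrite ler_wpM2l// ler_wpM2r.
have Q3 : 0 <= 3 * Q by exact: mulr_ge0.
rewrite mulrC ler_wpM2l//.
have := rho_ge0 1; have := rho_ge0 2; have := rho_ge0 3; have := rho_ge0 4.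
by rewrite expr1; move: k k4 => [|[|[|[|[|//]]]]]// _; rewrite ?expr1; lra.
Qed.

Let bound_with k c v y : v0 <= v -> (0 < k <= 4)%N -> c <= 3 -> `|y| <= c * Q ->
  `|r v ^+ k * y| <= C.
Proof.
move=> v0v k4 c3 yc; apply: le_trans (C_ge k4 c3).
by rewrite normrM ler_pM// r_bound.
Qed.

Lemma heat1_bound v x : v0 <= v -> `|heat1 v x| <= C.
Proof.
move=> v0v; rewrite normrN -[r v]expr1; apply: (bound_with v0v (c := 1)) => //; first by lra.
have [? _] := gauss_pdf_moments (z v x).
by rewrite mul1r ger0_norm ?gauss_pdf_ge0.
Qed.

Lemma heat2_bound v x : v0 <= v -> `|heat2 v x| <= C.
Proof.
move=> v0v; rewrite normrN; apply: (bound_with v0v (c := 1)) => //; first by lra.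
have [_ [? _]] := gauss_pdf_moments (z v x).
by rewrite mul1r normrM (ger0_norm (gauss_pdf_ge0 _)).
Qed.

Lemma heat3_bound v x : v0 <= v -> `|heat3 v x| <= C.
Proof.
move=> v0v; rewrite /heat3 -mulrA; apply: (bound_with v0v (c := 2)) => //; first by lra.
have [a0 [_ [a2 _]]] := gauss_pdf_moments (z v x).
rewrite mulrBl mul1r; apply: le_trans (ler_normB _ _) _.
rewrite normrM [ `| _ ^+ 2|]ger0_norm ?sqr_ge0// (ger0_norm (gauss_pdf_ge0 _)).
by rewrite mulrDl mul1r lerD.
Qed.

Lemma heat2_time_bound v x : v0 <= v -> `|heat2_time v x| <= C.
Proof.
move=> v0v; rewrite /heat2_time -mulrA; apply: (bound_with v0v (c := 2)) => //; first by lra.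
have [_ [a1 [_ a3]]] := gauss_pdf_moments (z v x).
have -> : (z v x + z v x * (1 - z v x ^+ 2) / 2) * gauss_pdf (z v x) =
  3 / 2 * (z v x * gauss_pdf (z v x)) - 2^-1 * (z v x ^+ 3 * gauss_pdf (z v x)).
  by field.
apply: le_trans (ler_normB _ _) _; rewrite (normrM (3 / 2)) (normrM 2^-1) (normrM (z v x)).
rewrite (normrM (z v x ^+ 3)) normrX.
rewrite (ger0_norm (gauss_pdf_ge0 _)) (ger0_norm (_ : 0 <= 2^-1))//.
rewrite (ger0_norm (_ : 0 <= 3 / 2)); last by lra.
by move: a1 a3; rewrite -/Q; lra.
Qed.

Lemma heat_lip v x a : v0 <= v -> `|heat v (x + a) - heat v x| <= C * `|a|.
Proof.
move=> v0v; apply: (le_mean_value_shift (is_derive_heat v)) => t _.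
exact: heat1_bound.
Qed.

Lemma heat2_lip v x a : v0 <= v -> `|heat2 v (x + a) - heat2 v x| <= C * `|a|.
Proof.
move=> v0v; apply: (le_mean_value_shift (is_derive_heat2 v)) => t _.
exact: heat3_bound.
Qed.

Lemma heat_taylor v x a : v0 <= v ->
  `|heat v (x + a) - heat v x - a * heat1 v x - a ^+ 2 / 2 * heat2 v x|
  <= C * `|a| ^+ 3.
Proof.
move=> v0v.
apply: (le_taylor2 _ _ heat_const_ge0 (is_derive_heat v) (is_derive_heat1 v)).
by move=> *; exact: heat2_lip.
Qed.

Lemma heat2_time_lip v x s : v0 <= v -> 0 <= s ->
  `|heat2 (v + s) x - heat2 v x| <= C * s.
Proof.
move=> v0v s0; rewrite -[X in C * X](addrK v) (addrC s).
apply: (@le_mean_value _ (heat2 ^~ x) (heat2_time ^~ x)); first by rewrite lerDl.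
  by move=> t /andP[vt _]; apply/is_derive_heat2_time/v_gt0/(le_trans v0v).
by move=> t /andP[vt _]; exact/heat2_time_bound/(le_trans v0v).
Qed.

Lemma heat_equation v x s : v0 <= v -> 0 <= s ->
  `|heat (v + s) x - heat v x - s / 2 * heat2 v x| <= C * s ^+ 2.
Proof.
(* By the heat equation [g] has derivative [(heat2 t x - heat2 v x) / 2], which is of order [s] on
   the interval; the mean value bound supplies the second factor [s]. *)
move=> v0v s0; pose g t := heat t x - (t - v) / 2 * heat2 v x.
have -> : heat (v + s) x - heat v x - s / 2 * heat2 v x = g (v + s) - g v.
  by rewrite /g; ring.
rewrite expr2 mulrA -[X in _ * X](addrK v) (addrC s v).
apply: (@le_mean_value _ _ (fun t => (heat2 t x - heat2 v x) / 2)).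
- by rewrite lerDl.
- move=> t /andP[vt _]; rewrite /g.
  have ? := is_derive_heat_time x (v_gt0 (le_trans v0v vt)).
  by apply: is_derive_eq; rewrite /GRing.scale/=; field.
- move=> t /andP[vt ts]; have tv : 0 <= t - v by rewrite subr_ge0.
  have := heat2_time_lip x v0v tv; rewrite (_ : v + (t - v) = t); last by ring.
  have : C * (t - v) <= C * s by rewrite ler_wpM2l ?heat_const_ge0//; lra.
  rewrite normrM (ger0_norm (_ : 0 <= 2^-1))//.
  by have := normr_ge0 (heat2 t x - heat2 v x); lra.
Qed.

End heat.

(** * Transfer from the probability space to sign paths *)

Section null_sets.
Context d (T : measurableType d) (R : realType) (P : probability T R).
Implicit Types A B N : set T.

(** The recalled indices and the signs take their prescribed values only almost surely, so events
    have to be compared off a null set. *)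
Lemma measure_eq_mod_null A B N : measurable A -> measurable B -> measurable N ->
  P N = 0%E -> A `\` N = B `\` N -> P A = P B.
Proof.
move=> mA mB mN N0 AB.
have split C : measurable C -> P C = P (C `\` N).
  move=> mC; rewrite [LHS](measureDI P mC mN) -[RHS]adde0; congr (_ + _)%E.
  apply: (@subset_measure0 _ _ _ _ _ N) => //; exact: measurableI.
by rewrite (split A)// (split B)// AB.
Qed.

End null_sets.

(** * Events independent of a family of sources *)

Section independent_of.
Context d (T : measurableType d) (R : realType) (P : probability T R).
Context (I : choiceType) (F : I -> set_system T).
Hypothesis F_measurable : forall i A, F i A -> measurable A.
Implicit Types (D : pred I) (S E N : set T) (c : R).

(* [S] has probability [c] and is independent of the sources indexed by [D]. *)
Definition independent_of D S c :=
  forall (J : {fset I}) (A : I -> set T), (forall i, i \in J -> D i) ->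
    (forall i, i \in J -> F i (A i)) ->
    P (S `&` \bigcap_(i in [set` J]) A i) = (c%:E * \prod_(i <- J) P (A i))%E.

Lemma measurable_bigcap_fset (J : {fset I}) (A : I -> set T) :
  (forall i, i \in J -> F i (A i)) -> measurable (\bigcap_(i in [set` J]) A i).
Proof.
move=> FA; apply: fin_bigcap_measurable; first exact: finite_fset.
by move=> i /= /FA /F_measurable.
Qed.

Lemma independent_of_measure D S c : independent_of D S c -> P S = c%:E.
Proof.
move=> /(_ fset0 (fun=> setT)) SD; move: SD; rewrite big_seq_fset0 mule1.
rewrite set_fset0 bigcap_set0 setIT; apply => //.
Qed.

(** Spending a fresh source: the hypothesis is applied to [J] enlarged by [i], with [E] placed at
    [i], and the product formula releases the factor [e]. *)
Lemma independent_of_setI D D' i S E c e :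
  independent_of D S c -> D i -> ~~ D' i -> {subset D' <= D} ->
  F i E -> P E = e%:E -> independent_of D' (S `&` E) (c * e).
Proof.
move=> indS Di D'i D'D FE PE J A JD FA.
have iJ : i \notin J by apply: contra D'i => /JD.
pose A' j := if j == i then E else A j.
have A'J j : j \in J -> A' j = A j.
  by move=> jJ; rewrite /A'; case: eqP => // ji; rewrite ji (negbTE iJ) in jJ.
have := indS (i |` J)%fset A'; rewrite big_fsetU1//= /A' eqxx.
rewrite PE (eq_big_seq (fun j => P (A j))); last first.
  by move=> j jJ; rewrite -/(A' j) A'J.
rewrite EFinM muleA => <-.
- congr (P _); rewrite -setIA; congr (_ `&` _); apply/seteqP; split=> w /=.
    move=> [Ew Aw] j /=; rewrite !inE => /orP[/eqP->|jJ]; first by rewrite eqxx.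
    by rewrite -/(A' j) A'J//; exact: Aw.
  move=> A'w; split; first by have := A'w i; rewrite /= eqxx; apply; rewrite fset1U1.
  move=> j /= jJ; have := A'w j; rewrite -/(A' j) A'J//; apply.
  by rewrite /= fset1Ur.
- by move=> j; rewrite !inE => /orP[/eqP->//|/JD]; exact: D'D.
- move=> j; rewrite !inE -/(A' j) => /orP[/eqP->|jJ]; first by rewrite /A' eqxx.
  by rewrite A'J//; exact: FA.
Qed.

Lemma independent_of_setU D S S' c c' : measurable S -> measurable S' ->
  S `&` S' = set0 -> independent_of D S c -> independent_of D S' c' ->
  independent_of D (S `|` S') (c + c').
Proof.
move=> mS mS' SS' indS indS' J A JD FA.
have mA := measurable_bigcap_fset FA.
(* Nonnegativity lets the extended real product distribute over [c + c']. *)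
have c0 : (0 <= c%:E)%E by rewrite -(independent_of_measure indS).
have c'0 : (0 <= c'%:E)%E by rewrite -(independent_of_measure indS').
rewrite setIUl measureU//=; last by rewrite setIACA SS' set0I.
- by rewrite indS// indS'// EFinD ge0_muleDl.
- exact: measurableI.
- exact: measurableI.
Qed.

Lemma independent_of_mod_null D S S' N c : measurable S -> measurable S' ->
  measurable N -> P N = 0%E -> S `\` N = S' `\` N ->
  independent_of D S c -> independent_of D S' c.
Proof.
move=> mS mS' mN N0 SS' indS J A JD FA; rewrite -indS//.
have mA := measurable_bigcap_fset FA.
apply: (measure_eq_mod_null (N := N)) => //; try exact: measurableI.
by rewrite !setDE -!(setIAC _ (~` N)) -!setDE SS'.
Qed.

End independent_of.

(** * The law of the first steps of the walk *)

Section path_law.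
Context d (T : measurableType d) (R : realType) (P : probability T R).
Context (p : R) (X : nat -> {RV P >-> R}) (K : nat -> {RV P >-> nat}).
Context (eps : nat -> {RV P >-> R}).
Hypothesis X_walk : elephant_two_recent P p X K eps.
Hypothesis X1_pos : P [set w | X 1%N w = 1] = p%:E.
Hypothesis X1_neg : P [set w | X 1%N w = -1] = (1 - p)%:E.
Notation sources := (elephant_sources X K eps).
Notation m := ((2 * p - 1) / 2).
Implicit Types (h : seq R) (w : T).

Fixpoint history n w : seq R :=
  if n is n'.+1 then X n'.+1 w :: history n' w else [::].

Definition path_event h : set T := [set w | history (size h) w = h].

(* The indices of the sources not yet used when [X n] has been formed. *)
Definition unused n (i : unit + (nat + nat)) : bool :=
  match i with
  | inl _ => n == 0%N
  | inr (inl j) => (n <= j.+2)%N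
  | inr (inr j) => (n <= j.+1)%N
  end.

Lemma path_event_cons x h :
  path_event (x :: h) = path_event h `&` [set w | X (size h).+1 w = x].
Proof.
by rewrite /path_event; apply/seteqP; split=> w /=; [case=> -> ->|move=> [-> ->]].
Qed.

Lemma measurable_RV_eq d' (T' : measurableType d') (Y : {RV P >-> T'}) y :
  measurable [set y] -> measurable [set w | Y w = y].
Proof.
move=> my; rewrite (_ : [set w | Y w = y] = setT `&` Y @^-1` [set y]); last first.
  by rewrite setTI.
exact: (@measurable_funP _ _ _ _ _ Y measurableT [set y] my).
Qed.

Lemma measurable_path_event h : measurable (path_event h).
Proof.
elim: h => [|x h IH]; last by rewrite path_event_cons; apply: measurableI => //;
  exact: measurable_RV_eq.
rewrite (_ : path_event _ = setT)//; exact/seteqP.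
Qed.

Lemma sources_measurable i A : sources i A -> measurable A.
Proof.
by case: i => [_|[j|j]] /= [B mB <-]; exact: measurable_funP measurableT _ mB.
Qed.

Lemma generated_sigma_eq d' (T' : measurableType d') (Y : {RV P >-> T'}) y :
  measurable [set y] -> generated_sigma Y [set w | Y w = y].
Proof. by move=> my; exists [set y] => //; rewrite setTI. Qed.

Lemma sign_prob n s : (s == 1) || (s == -1) ->
  P [set w | eps n.+1 w = s] = ((1 + s * (2 * p - 1)) / 2)%:E.
Proof.
have [e1 eN1] := sign_choice X_walk (ltn0Sn n).
by case/orP => /eqP->; rewrite ?e1 ?eN1; congr EFin; field.
Qed.

Lemma sign_mul (a b : R) : (a == 1) || (a == -1) -> (b == 1) || (b == -1) ->
  (a * b == 1) || (a * b == -1).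
Proof.
by case/orP => /eqP-> /orP[]/eqP->; rewrite ?mul1r ?mulN1r ?opprK eqxx ?orbT.
Qed.

Lemma sign_mulK (x y e : R) : (y == 1) || (y == -1) -> (e * y = x) <-> (e = x * y).
Proof.
by case/orP => /eqP->; rewrite ?mulr1 ?mulrN1//; split => [<-|->]; rewrite opprK.
Qed.

Let off_choice n : set T := ~` ([set w | K n w = n.-1] `|` [set w | K n w = n]).

Let measurable_K n k : measurable [set w | K n w = k].
Proof. exact: measurable_RV_eq. Qed.

Let measurable_off_choice n : measurable (off_choice n).
Proof. by apply: measurableC; apply: measurableU; exact: measurable_K. Qed.

Let off_choice0 n : (2 <= n)%N -> P (off_choice n) = 0%E.
Proof.
move=> n2; have [K1 K2] := index_choice X_walk n2.
rewrite /off_choice probability_setC; last by apply: measurableU; exact: measurable_K.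
rewrite measureU//=; try exact: measurable_K.
  have h : 2^-1 + 2^-1 = 1 :> R by field.
  by rewrite K1 K2 -EFinD h subrr.
apply/seteqP; split=> // w /= [->] /eqP.
by case: n n2 {K1 K2} => [|n]// _; rewrite ltn_eqF.
Qed.

Lemma path_event_independent h : h \in sign_paths R (size h) ->
  independent_of P sources (unused (size h)) (path_event h) (path_weight m h).
Proof.
elim: h => [_|x h IH].
  move=> J A _ FA; rewrite mul1e (_ : path_event _ = setT) ?setTI.
    by move: J A FA; exact: (choices_independent X_walk).
  exact/seteqP.
rewrite [size _]/= sign_pathsS => /andP[x1 hn].
have ind := IH hn; have mh := measurable_path_event h.
have mxh := measurable_path_event (x :: h); clear IH.
rewrite (_ : path_weight _ _ = path_weight m h * ((1 + x * drift m h) / 2))//.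
case: h hn mh mxh ind => [|y [|z h]] hn mh mxh ind.
- rewrite path_event_cons; apply: (independent_of_setI (i := inl tt) ind) => //.
  + by move=> [u|[j|j]].
  + exact: generated_sigma_eq.
  + by rewrite /=; case/orP: x1 => /eqP->; rewrite ?X1_pos ?X1_neg; congr EFin; field.
- move: hn; rewrite sign_pathsS => /andP[y1 _].
  rewrite path_event_cons (_ : _ `&` _ =
      path_event [:: y] `&` [set w | eps 1%N w = x * y]); last first.
    apply/seteqP; split=> w; rewrite /path_event /= => -[[X1y] e]; (split; first by rewrite X1y).
      by apply/(@sign_mulK x y _ y1); rewrite -e (second_step X_walk) X1y.
    by rewrite (second_step X_walk) X1y; apply/(@sign_mulK x y _ y1).
  apply: (independent_of_setI (i := inr (inr 0%N)) ind) => //.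
  + by move=> [?|[j|j]]//=; rewrite !inE/= => /ltnW.
  + exact: generated_sigma_eq.
  + by rewrite sign_prob ?sign_mul//; congr EFin; rewrite /=; field.
move: (hn); rewrite !sign_pathsS => /and3P[y1 z1 _].
set n := (size h).+2; set H := path_event [:: y, z & h] in mh ind *.
(* If step [k] has the sign [v], the new step is [x] exactly when the applied sign is [x * v]. *)
pose branch k v := H `&` [set w | K n w = k] `&` [set w | eps n w = x * v].
have mK k : measurable (H `&` [set w | K n w = k]) by exact: measurableI.
have mB k v : measurable (branch k v).
  by apply: measurableI => //; exact: measurable_RV_eq.
have branch_ind k v : (k == n.-1) || (k == n) -> (v == 1) || (v == -1) ->
    independent_of P sources (unused n.+1) (branch k v)
      (path_weight m [:: y, z & h] * 2^-1 * ((1 + x * v * (2 * p - 1)) / 2)).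
  move=> k1 v1; have [K1 K2] := index_choice X_walk (isT : (2 <= n)%N).
  (* The sources left between the two choices: with [n = (size h).+2], the index
     [inr (inl (size h))] is [K n], and [inr (inr (size h).+1)] is [eps n]. *)
  pose D i := (unused n i) && (i != inr (inl (size h))).
  apply: (@independent_of_setI _ _ _ _ _ sources D _
    (inr (inr (size h).+1))) => //.
  - apply: (@independent_of_setI _ _ _ _ _ sources (unused n) _
      (inr (inl (size h)))) => //.
    + by rewrite /unused /= leqnn.
    + by rewrite /D eqxx andbF.
    + by move=> i /andP[].
    + exact: generated_sigma_eq.
    + by case/orP: k1 => /eqP->; [exact: K1|exact: K2].
  - by rewrite /D /= leqnn.
  - by rewrite /= ltnn.
  - move=> [?|[j|j]]//; rewrite /in_mem /D /= => ij; rewrite ltnW//=.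
    by apply/eqP => -[] ji; rewrite ji ltnn in ij.
  - exact: generated_sigma_eq.
  - by rewrite sign_prob// sign_mul.
have -> : path_weight m [:: y, z & h] * ((1 + x * drift m [:: y, z & h]) / 2) =
    path_weight m [:: y, z & h] * 2^-1 * ((1 + x * y * (2 * p - 1)) / 2) +
    path_weight m [:: y, z & h] * 2^-1 * ((1 + x * z * (2 * p - 1)) / 2).
  by rewrite [drift _ _]/=; field.
(* Off the null event where [K n] is neither [n.-1] nor [n], the two disjoint branches make up the
   event of the longer path. *)
apply: (independent_of_mod_null sources_measurable _ mxh (measurable_off_choice n)
  (off_choice0 _) _ (independent_of_setU sources_measurable _ _ _
    (branch_ind n y _ y1) (branch_ind n.-1 z _ z1))) => //.
- exact: measurableU.
- rewrite path_event_cons -/H; apply/seteqP; split=> w [S off]; (split; last by []); move: S.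
  move=> /= [] [[Hw Kw] e]; split=> //=; have := Hw; rewrite /H /path_event /=.
      move=> [Xy Xz _]; rewrite (next_step X_walk)//= Kw Xy e.
      by apply/sign_mulK.
    move=> [Xy Xz _]; rewrite (next_step X_walk)//= Kw Xz e.
    by apply/sign_mulK.
  case=> Hw; rewrite /= (next_step X_walk)// => Xx.
  have := Hw; rewrite /H /path_event /= => -[Xy Xz _].
  move: off => /contrapT[Kw|Kw]; [right|left].
    by (split; first by split); apply/sign_mulK => //; rewrite -Xx (_ : K _ w = n.-1)// -Xz.
  by (split; first by split); apply/sign_mulK => //; rewrite -Xx (_ : K _ w = n)// -Xy.
- apply/seteqP; split=> // w [[[_ Kn] _] [[_ Kn1] _]].
  by have /eqP := etrans (esym Kn) Kn1; rewrite gtn_eqF.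
- by rewrite eqxx orbT.
- by rewrite eqxx.
Qed.

Lemma path_event_measure n h : h \in sign_paths R n ->
  P (path_event h) = (path_weight m h)%:E.
Proof.
move=> hn; apply: independent_of_measure (path_event_independent _).
by rewrite (sign_paths_size hn).
Qed.

(** The weights of the two extensions of [h] add up to that of [h], so the extensions exhaust its
    event up to a null set. Hence the sign paths cover almost the whole space. *)
Lemma measure_sign_paths n A : measurable A ->
  P A = (\sum_(h <- sign_paths R n) P (A `&` path_event h))%E.
Proof.
move=> mA; elim: n => [|n IH].
  by rewrite big_seq1 (_ : path_event _ = setT) ?setIT//; exact/seteqP.
rewrite IH /= big_cat/= !big_map -big_split/= big_seq [RHS]big_seq.
apply: eq_bigr => h hn.
have mh := measurable_path_event.
have h1 : 1 :: h \in sign_paths R n.+1 by rewrite sign_pathsS eqxx.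
have hN1 : -1 :: h \in sign_paths R n.+1 by rewrite sign_pathsS eqxx orbT.
have disj B C : (B `&` path_event (1 :: h)) `&` (C `&` path_event (-1 :: h)) = set0.
  rewrite !path_event_cons; apply/seteqP; split=> // w /= [[_ [_ ->]] [_ [_ /eqP]]].
  by rewrite eq_sym lt_eqF//; lra.
set H := path_event (1 :: h) `|` path_event (-1 :: h).
have HP : P (path_event h `\` H) = 0%E.
  rewrite measureD//=; last 2 first.
  - exact: measurableU.
  - by rewrite (path_event_measure hn) ltry.
  rewrite (_ : _ `&` _ = H); last first.
    by apply/setIidr; rewrite /H !path_event_cons => w [] [].
  rewrite measureU//=; last by have := disj setT setT; rewrite !setTI.
  rewrite (path_event_measure hn) (path_event_measure h1) (path_event_measure hN1).
  by rewrite -EFinD; congr EFin; rewrite /=; field.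
rewrite (_ : P (A `&` path_event h) = P (A `&` H)).
  rewrite setIUr measureU//=; exact: measurableI.
apply: (measure_eq_mod_null (N := path_event h `\` H)) => //.
- exact: measurableI.
- by apply: measurableI => //; exact: measurableU.
- by apply: measurableD => //; exact: measurableU.
apply/seteqP; split=> w /= [[Aw Hw]] nH; split => //; split => //.
  by apply: contrapT => /(conj Hw) /nH.
by move: Hw; rewrite /H !path_event_cons => -[[]|[]].
Qed.

(** The bridge to the finite sums: it applies to every measurable event decided by the first [n]
    steps. *)
Lemma measure_path_expect n A (Q : pred (seq R)) : measurable A ->
  (forall w, A w <-> Q (history n w)) ->
  P A = (path_expect m n (fun h => (Q h)%:R))%:E.
Proof.
move=> mA AQ; rewrite (measure_sign_paths n mA) /path_expect -sumEFin.
rewrite big_seq [RHS]big_seq; apply: eq_bigr => h hn.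
have hE w : path_event h w -> history n w = h.
  by rewrite /path_event /= (sign_paths_size hn).
case: (boolP (Q h)) => Qh.
  rewrite mulr1 -(path_event_measure hn); congr (P _); apply/setIidr => w /hE wh.
  by apply/AQ; rewrite wh.
rewrite mulr0 (_ : _ `&` _ = set0) ?measure0//; apply/seteqP; split=> // w [/AQ + /hE wh].
by rewrite wh (negbTE Qh).
Qed.

Lemma sum_history n w : \sum_(x <- history n w) x = walk X n w.
Proof.
rewrite /walk; elim: n => [|n IH]; first by rewrite big_nil big_geq.
by rewrite big_cons IH addrC -big_nat_recr.
Qed.

End path_law.

(** * Strong law of large numbers *)

Section averages.
Context (R : realType).

Lemma fourth_root_bounds n : (0 < n)%N ->
  exists k, (k.+1 ^ 4 <= n < k.+2 ^ 4)%N.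
Proof.
elim: n => // -[|n] IH _; first by exists 0%N.
have [k /andP[k1 k2]] := IH isT.
have [h|h] := ltnP n.+2 (k.+2 ^ 4); first by exists k; rewrite h (leq_trans k1).
by exists k.+1; rewrite h (leq_ltn_trans k2)// ltn_exp2r.
Qed.

(** Consecutive fourth powers leave at most [15 (k+1)^3] further bounded steps, so the sum is at
    most [16 (k+1)^3], which is below [e (k+1)^4] once [k + 1 >= 16 / e]. *)
Lemma average_cvg0 (x : nat -> R) (N : nat) :
  (forall i, `|x i.+1| <= 1) ->
  (forall k, (N <= k)%N ->
    `|\sum_(1 <= i < (k.+1 ^ 4).+1) x i| <= k.+1%:R ^+ 3) ->
  (\sum_(1 <= i < n.+1) x i) / n%:R @[n --> \oo] --> (0 : R).
Proof.
move=> x1 xN; apply/cvgrPdist_le => e e0.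
pose k0 := (maxn N (Num.truncn (16 / e))).
exists (k0.+1 ^ 4)%N => // n /= kn.
have n0 : (0 < n)%N by rewrite (leq_trans _ kn)// expn_gt0.
have [k /andP[kn1 kn2]] := fourth_root_bounds n0.
have kk : (k0 <= k)%N.
  by have := leq_ltn_trans kn kn2; rewrite ltn_exp2r.
rewrite sub0r normrN normrM normfV (ger0_norm (ler0n _ n)) ler_pdivrMr ?ltr0n//.
rewrite (big_cat_nat _ (n := (k.+1 ^ 4).+1))//=.
have k3 := xN k (leq_trans (leq_maxl _ _) kk).
have gap : `|\sum_((k.+1 ^ 4).+1 <= i < n.+1) x i| <= 15 * k.+1%:R ^+ 3.
  apply: le_trans (ler_norm_sum _ _ _) _.
  apply: (@le_trans _ _ (\sum_((k.+1 ^ 4).+1 <= i < n.+1) 1)).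
    by rewrite big_nat [leRHS]big_nat; apply: ler_sum => -[|i]//.
  rewrite sumr_const_nat -natrX -natrM ler_nat subSS.
  have : (k.+2 ^ 4 <= k.+1 ^ 4 + 15 * k.+1 ^ 3 + 1)%N by nia.
  lia.
apply: le_trans (ler_normD _ _) _; apply: le_trans (lerD k3 gap) _.
apply: (@le_trans _ _ (e * k.+1%:R ^+ 4)); last first.
  by rewrite ler_pM2l// -natrX ler_nat.
have ek : 16 <= e * k.+1%:R.
  rewrite mulrC -ler_pdivrMr//; apply: le_trans (ltW (truncnS_gt _)) _.
  by rewrite ler_nat ltnS (leq_trans _ kk)// leq_maxr.
have := ler_wpM2r (exprn_ge0 3 (ler0n R k.+1)) ek.
by rewrite [_ ^+ 4]exprS mulrA; lra.
Qed.

End averages.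

(** * Deviation bounds and Borel-Cantelli *)

Section strong_law.
Context d (T : measurableType d) (R : realType) (P : probability T R).
Context (p : R) (X : nat -> {RV P >-> R}) (K : nat -> {RV P >-> nat}).
Context (eps : nat -> {RV P >-> R}).
Hypotheses (p_gt0 : 0 < p) (p_lt1 : p < 1).
Hypothesis X_walk : elephant_two_recent P p X K eps.
Hypothesis X1_pos : P [set w | X 1%N w = 1] = p%:E.
Hypothesis X1_neg : P [set w | X 1%N w = -1] = (1 - p)%:E.
Notation m := ((2 * p - 1) / 2).

Let m_bound : `|m| <= 1 / 2.
Proof. by move: p_gt0 p_lt1 => ? ?; rewrite ler_norml; apply/andP; lra. Qed.

Let m_lt : m < 1 / 2.
Proof. by move: p_lt1 => ?; lra. Qed.

Let law n A Q := @measure_path_expect _ _ _ _ _ _ _ _ X_walk X1_pos X1_neg n A Q.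

Lemma steps_le1 : {ae P, forall w, forall i, `|X i.+1 w| <= 1}.
Proof.
apply/ae_foralln => i; set A := [set w | `|X i.+1 w| <= 1].
have mA : measurable A.
  rewrite (_ : A = setT `&` (fun w => `|X i.+1 w|) @^-1` `]-oo, 1]%classic).
    by apply: measurableT_comp.
  by rewrite setTI; apply/seteqP; split=> w /=; rewrite in_itv.
have PA : P A = 1%E.
  rewrite (law (n := i.+1) (Q := fun h => `|head 0 h| <= 1))//; congr EFin.
  rewrite -[RHS](path_expect_cst m i.+1); apply: eq_path_expect => -[|x h].
    by move/sign_paths_size.
  by rewrite sign_pathsS => /andP[/orP[]/eqP-> _] /=; rewrite ?normrN normr1 lexx.
exists (~` A); split => //; first exact: measurableC.
by apply: etrans (probability_setC P mA) _; rewrite PA subee.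
Qed.

Lemma measurable_abs_walk_gt n (t : R) : measurable [set w | (t < `|walk X n w|)%R].
Proof.
rewrite (_ : [set w | _] = setT `&` (fun w => `|walk X n w|) @^-1` `]t, +oo[%classic).
  by apply: measurableT_comp => //; exact: measurable_walk.
by rewrite setTI; apply/seteqP; split=> w /=; rewrite in_itv/= andbT.
Qed.

(** Chebyshev's inequality, carried out on the weighted sum over paths. *)
Lemma deviation_bound n (t : R) : 0 < t ->
  (P [set w | (t < `|walk X n.+1 w|)%R] <=
    (80 / (1 - 2 * m) ^+ 2 * n.+1%:R / t ^+ 2)%:E)%E.
Proof.
move=> t0; have mA : measurable [set w | (t < `|walk X n.+1 w|)%R].
  exact: measurable_abs_walk_gt.
rewrite (law (n := n.+1) (Q := fun h => t < `|\sum_(x <- h) x|)) ?lee_fin//; last first.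
  by move=> w; rewrite sum_history.
rewrite ler_pdivlMr ?exprn_gt0// mulrC -path_expectZ.
apply: le_trans (path_expect_sum_sqr _ n m_lt) => //.
apply: le_path_expect => // h _; case: ltP => [th|_]; last by rewrite mulr0 sqr_ge0.
by rewrite mulr1 -(real_normK (num_real (\sum_(x <- h) x))) lerXn2r// ?nnegrE ltW.
Qed.

Lemma sum_inv_sqr_le n : \sum_(0 <= k < n) (k.+1%:R ^+ 2)^-1 <= 2 :> R.
Proof.
case: n => [|n]; first by rewrite big_geq.
(* Strengthened so that the induction closes, by [1 / (y+1)^2 <= 1 / y - 1 / (y+1)]. *)
suff : \sum_(0 <= k < n.+1) (k.+1%:R ^+ 2)^-1 <= 2 - n.+1%:R^-1 :> R.
  by move=> /le_trans; apply; rewrite gerDl oppr_le0 invr_ge0.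
elim: n => [|n IH]; first by rewrite big_nat1 expr1n invr1; lra.
rewrite big_nat_recr//=; apply: le_trans (lerD IH (lexx _)) _.
rewrite -[n.+2%:R]natr1; have := ltr0n R n.+1; set y := n.+1%:R; rewrite ltr0Sn => y0.
have -> : 2 - (y + 1)^-1 = 2 - y^-1 + ((y + 1) ^+ 2)^-1 + (y * (y + 1) ^+ 2)^-1.
  by field; rewrite !gt_eqF//; lra.
by rewrite lerDl invr_ge0 mulr_ge0 ?sqr_ge0// ltW.
Qed.

Lemma walk_strong_law : {ae P, forall w, walk X n w / n%:R @[n --> \oo] --> (0 : R)}.
Proof.
pose F k := [set w | ((k.+1%:R ^+ 3 : R) < `|walk X (k.+1 ^ 4)%N w|)%R].
have mF k : measurable (F k) by exact: measurable_abs_walk_gt.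
pose c := 80 / (1 - 2 * m) ^+ 2.
have c0 : 0 <= c by rewrite divr_ge0// sqr_ge0.
have PF k : (P (F k) <= (c * (k.+1%:R ^+ 2)^-1)%:E)%E.
  have k0 : 0 < k.+1%:R ^+ 3 :> R by rewrite exprn_gt0.
  (* At time [(k+1)^4] and level [(k+1)^3] the bound is [c (k+1)^4 / (k+1)^6], hence summable. The
     predecessor matches the successor in the statement of the bound. *)
  have := @deviation_bound (k.+1 ^ 4).-1 _ k0.
  rewrite prednK ?expn_gt0// => /le_trans; apply; rewrite lee_fin natrX.
  have k1 : k.+1%:R != 0 :> R by rewrite pnatr_eq0.
  rewrite le_eqVlt; apply/orP; left; apply/eqP; rewrite -/c.
  by set y := k.+1%:R in k1 *; field.
have F0 : P (lim_sup_set F) = 0%E.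
  apply: lim_sup_set_cvg0 => //.
  apply: (@le_lt_trans _ _ (c * 2)%:E); last exact: ltry.
  apply: lime_le; first exact: is_cvg_nneseries.
  apply: nearW => n; apply: (@le_trans _ _ (\sum_(0 <= k < n) (c * (k.+1%:R ^+ 2)^-1)%:E)%E).
    by apply: lee_sum => k _; exact: PF.
  by rewrite sumEFin lee_fin -mulr_sumr ler_wpM2l// sum_inv_sqr_le.
have aeF : {ae P, forall w, ~ lim_sup_set F w}.
  exists (lim_sup_set F); split => //; last by move=> w /= /contrapT.
  by apply: bigcap_measurable => // k _; exact: bigcup_measurable.
apply: filterS2 aeF steps_le1 => w Fw w1.
have [N FN] : exists N, forall k, (N <= k)%N -> ~ F k w.
  apply: contrapT => h; apply: Fw => n _; apply: contrapT => Fn; apply: h.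
  by exists n => k nk Fk; apply: Fn; exists k.
apply: (@average_cvg0 _ _ N) => // k /FN.
by rewrite /F /= => /negP; rewrite -leNgt.
Qed.

End strong_law.

(** * Central limit theorem *)

Section smoothing.
Context (R : realType).
Implicit Types (x w y : R).

Lemma gauss_cdf_lipschitz x y :
  `|gauss_cdf x - gauss_cdf y| <= 10 * normal_peak (1 : R) * `|x - y|.
Proof.
have := @le_mean_value_shift R (@gauss_cdf R) _ y (x - y) (10 * normal_peak 1)
  (@is_derive_gauss_cdf R).
rewrite (_ : y + (x - y) = x); last by ring.
apply=> t _.
by rewrite ger0_norm ?gauss_pdf_ge0//; have [] := gauss_pdf_moments t.
Qed.

Lemma gauss_cdf_tails (e : R) : 0 < e ->
  exists2 y, 0 < y & gauss_cdf (- y) <= e /\ 1 - gauss_cdf y <= e.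
Proof.
move=> e0.
have /cvgrPdist_le/(_ e e0)[M [_ MP]] := @cvg_gauss_cdfNy R.
have /cvgrPdist_le/(_ e e0)[N [_ NP]] := @cvg_gauss_cdfy R.
exists (`|M| + `|N| + 1); first by rewrite ltr_wpDl ?addr_ge0.
split.
  have := MP (- (`|M| + `|N| + 1)); rewrite sub0r normrN (ger0_norm (gauss_cdf_ge0 _)).
  by apply; have := ler_norm (- M); rewrite normrN; have := normr_ge0 N; lra.
have := NP (`|M| + `|N| + 1); rewrite (ger0_norm (_ : 0 <= 1 - _)) ?subr_ge0 ?gauss_cdf_le1//.
by apply; have := ler_norm N; have := normr_ge0 M; lra.
Qed.

(* [heat b (delta ^+ 2)] is the indicator of [w <= b] blurred at scale [delta];
   shifting the threshold by [y * delta] makes it a bound up to a Gaussian tail. *)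
Lemma indicator_le_heat x w y (delta : R) : 0 < delta ->
  (w <= x)%R%:R <= heat (x + y * delta) (delta ^+ 2) w + (1 - gauss_cdf y).
Proof.
move=> d0; rewrite /heat sqrtr_sqr gtr0_norm//.
case: (leP w x) => [wx|_]; last first.
  by rewrite mulr0n addr_ge0 ?gauss_cdf_ge0// subr_ge0 gauss_cdf_le1.
rewrite mulr1n addrCA lerDl subr_ge0; apply: gauss_cdf_nondecreasing.
by rewrite ler_pdivlMr//; lra.
Qed.

Lemma heat_le_indicator x w y (delta : R) : 0 < delta ->
  heat (x - y * delta) (delta ^+ 2) w - gauss_cdf (- y) <= (w <= x)%R%:R.
Proof.
move=> d0; rewrite /heat sqrtr_sqr gtr0_norm// lerBlDr.
case: (leP w x) => [wx|xw].
  by rewrite mulr1n (le_trans (gauss_cdf_le1 _))// lerDl gauss_cdf_ge0.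
rewrite mulr0n add0r; apply: gauss_cdf_nondecreasing.
by rewrite ler_pdivrMr//; lra.
Qed.

(** The flow at [0] is the normal distribution function at [(x + y * delta) / s] with
    [s = sqrt (1 + delta ^ 2)]; from [1 <= s <= 1 + delta] this argument is within
    [(|x| + |y|) * delta] of [x]. *)
Lemma heat_unit_dist x y (delta : R) : 0 < delta -> delta <= 1 ->
  `|heat (x + y * delta) (delta ^+ 2 + 1) 0 - gauss_cdf x|
    <= 10 * normal_peak (1 : R) * ((`|x| + `|y|) * delta).
Proof.
move=> d0 d1; rewrite /heat subr0; apply: le_trans (gauss_cdf_lipschitz _ _) _.
rewrite ler_wpM2l ?mulr_ge0 ?normal_peak_ge0//.
set s := Num.sqrt _.
have s2 : s ^+ 2 = delta ^+ 2 + 1 by rewrite sqr_sqrtr// addr_ge0 ?sqr_ge0.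
have s1 : 1 <= s.
  by rewrite -sqrtr1 ler_wsqrtr// lerDr sqr_ge0.
have sr : 0 < s^-1 <= 1 by rewrite invr_gt0 invf_le1 (lt_le_trans _ s1)//= ltr01.
have -> : (x + y * delta) / s - x = y * (delta * s^-1) - x * (1 - s^-1) by ring.
apply: le_trans (ler_normB _ _) _; rewrite !normrM mulrDl addrC lerD//.
  rewrite ler_wpM2l// ger0_norm ?subr_ge0; last by case/andP: sr.
  have sd : s <= 1 + delta by rewrite -ler_sqr ?nnegrE ?s2; nra.
  have : (s - 1) / s <= delta.
    by rewrite ler_pdivrMr ?(lt_le_trans _ s1)//; nra.
  by rewrite mulrBl mul1r divff// gt_eqF// (lt_le_trans _ s1).
rewrite ler_wpM2l// -normrM ger0_norm ?mulr_ge0 ?(ltW d0) ?invr_ge0 ?(le_trans _ s1)//.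
by rewrite ler_piMr ?(ltW d0)//; case/andP: sr.
Qed.

End smoothing.

(** * Convergence of the distribution functions *)

Section central_limit.
Context d (T : measurableType d) (R : realType) (P : probability T R).
Context (p sigma : R) (X : nat -> {RV P >-> R}) (K : nat -> {RV P >-> nat}).
Context (eps : nat -> {RV P >-> R}).
Hypotheses (p_gt0 : 0 < p) (p_lt1 : p < 1).
Hypothesis X_walk : elephant_two_recent P p X K eps.
Hypothesis X1_pos : P [set w | X 1%N w = 1] = p%:E.
Hypothesis X1_neg : P [set w | X 1%N w = -1] = (1 - p)%:E.
Hypothesis sigma_gt0 : 0 < sigma.
Hypothesis sigmaE : sigma ^+ 2 =
  1 + (2 * p - 1) * (5 - 2 * p) / (2 * (1 - p) * (3 - 2 * p)).
Notation m := ((2 * p - 1) / 2).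
Notation tau2 := (limit_variance m).

Let m_gt : - (1 / 2) < m. Proof. by move: p_gt0; lra. Qed.
Let m_lt : m < 1 / 2. Proof. by move: p_lt1; lra. Qed.
Let m_bound : `|m| <= 1 / 2.
Proof. by rewrite ler_norml; apply/andP; split; exact: ltW. Qed.

(** The martingale follows [(1 - 2 m) S_n], so its variance per step is that of the walk times
    [(1 - 2 m) ^ 2]. *)
Let limit_varianceE : tau2 = (sigma * (1 - 2 * m)) ^+ 2.
Proof.
rewrite exprMn sigmaE /limit_variance; move: p_gt0 p_lt1 => ? ?.
by field; rewrite !gt_eqF//; lra.
Qed.

Let path_cdf n (x : R) : R := path_expect m n
  (fun h => ((\sum_(i <- h) i) / (sigma * Num.sqrt n%:R) <= x)%R%:R).

Lemma cdf_normalized_walk n x :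
  cdf (normalized_walk X sigma n : {RV P >-> R}) x = (path_cdf n x)%:E.
Proof.
apply: (measure_path_expect X_walk X1_pos X1_neg).
  rewrite -[X in measurable X]setTI.
  exact: measurable_normalized_walk.
by move=> w /=; rewrite sum_history in_itv/=.
Qed.

Lemma path_cdf_cvg x : path_cdf n x @[n --> \oo] --> gauss_cdf x.
Proof.
apply/cvgrPdist_le => e e0.
have e4 : 0 < e / 4 by rewrite divr_gt0.
have [y y0 [tailN tail]] := gauss_cdf_tails e4.
set Q := 10 * normal_peak (1 : R).
have Q0 : 0 <= Q by rewrite mulr_ge0// normal_peak_ge0.
(* The order of choices matters: [y] makes the tails at most [e / 4], then [delta] makes the
   blurring error at most [e / 4], and only then does [n] grow, since [C] depends on [delta]. *)
pose L := Q * (`|x| + `|y|).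
have L0 : 0 <= L by rewrite mulr_ge0// addr_ge0.
pose delta := e / (4 * L + e).
have Le : 0 < 4 * L + e by lra.
have d0 : 0 < delta by rewrite divr_gt0.
have d1 : delta <= 1 by rewrite ler_pdivrMr//; lra.
have Ld : L * delta <= e / 4.
  by rewrite /delta mulrA ler_pdivrMr//; nra.
have v0 : 0 < delta ^+ 2 by rewrite exprn_gt0.
have tau0 : 0 < tau2 by exact: limit_variance_gt0.
pose C := heat_const (delta ^+ 2) * (160 + 48 / tau2).
have C0 : 0 <= C.
  by rewrite mulr_ge0 ?heat_const_ge0// addr_ge0// divr_ge0// ltW.
(* The scale with [n * step n ^ 2 * tau2 = 1]; times [1 - 2 m] it becomes [1 / (sigma sqrt n)]. *)
pose step n : R := (Num.sqrt tau2 * Num.sqrt n%:R)^-1.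
have compare b n : step n.+2 <= 1 ->
    `|path_expect m n.+2 (fun h =>
        heat b (delta ^+ 2) ((\sum_(i <- h) i) / (sigma * Num.sqrt n.+2%:R)))
      - heat b (delta ^+ 2 + 1) 0| <= C * step n.+2.
  move=> s1; have s0 : 0 < step n.+2 by rewrite invr_gt0 mulr_gt0 ?sqrtr_gt0.
  have sn : n.+2%:R * (step n.+2 ^+ 2 * tau2) = 1.
    rewrite /step exprVn exprMn !sqr_sqrtr ?ltW//.
    by field; rewrite -(natrD R 2 n) pnatr_eq0 (gt_eqF tau0).
  have := path_expect_heat m_gt m_lt (heat_const_ge0 v0) (heat_taylor b v0)
    (heat_equation b v0) (heat_lip b v0) (heat2_bound b v0) (heat2_lip b v0)
    (heat2_time_lip b v0) s0 s1 sn.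
  rewrite -/C; congr (`|_ - _| <= _); apply: eq_path_expect => h _.
  congr (heat _ _ _); rewrite /step limit_varianceE sqrtr_sqr gtr0_norm; last first.
    by rewrite mulr_gt0//; move: m_lt; lra.
  set t := Num.sqrt _; have t0 : t != 0 by rewrite gt_eqF ?sqrtr_gt0.
  by move: p_lt1 => ?; field; rewrite t0 !gt_eqF//; lra.
have [N NP] : exists N, forall n, (N <= n)%N -> step n.+2 <= 1 /\ C * step n.+2 <= e / 4.
  (* Once [step] is at most [1 / M], both [step <= 1] and [C * step <= e / 4] follow. *)
  pose M := 1 + 4 * C / e.
  have M1 : 1 <= M.
    by rewrite lerDl; apply: divr_ge0; [exact: mulr_ge0|exact: ltW].
  exists (Num.truncn (M ^+ 2 / tau2)).+1 => n Nn.
  have Ms : M <= Num.sqrt tau2 * Num.sqrt n.+2%:R.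
    rewrite -sqrtrM ?(ltW tau0)// (_ : M = Num.sqrt (M ^+ 2)); last first.
      by rewrite sqrtr_sqr ger0_norm// (le_trans ler01).
    rewrite ler_wsqrtr// mulrC -ler_pdivrMr//.
    apply: le_trans (ltW (truncnS_gt _)) _.
    by rewrite ler_nat (leq_trans Nn)// -addn2 leq_addr.
  have M0 : 0 < M by lra.
  have sM : step n.+2 <= M^-1 by rewrite lef_pV2 ?posrE// (lt_le_trans M0).
  split; first by apply: le_trans sM _; rewrite invf_le1.
  apply: le_trans (ler_wpM2l C0 sM) _; rewrite ler_pdivrMr//.
  have -> : e / 4 * M = e / 4 + C by rewrite /M; field; rewrite gt_eqF.
  by lra.
exists N.+2 => // -[|[|n]]//= Nn; have [s1 Ce] := NP n Nn.
have h1 := compare (x + y * delta) n s1.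
have h2 := compare (x + (- y) * delta) n s1.
have h3 := heat_unit_dist x y d0 d1.
have h4 := heat_unit_dist x (- y) d0 d1.
have LE : Q * ((`|x| + `|y|) * delta) = L * delta by rewrite mulrA.
rewrite normrN in h4; rewrite -/Q LE in h3 h4.
set F := path_cdf _ _.
(* The distribution function is squeezed between two blurred ones; on each side the tail, the
   comparison and the blurring cost at most [e / 4] each. *)
have up : F <= path_expect m n.+2 (fun h =>
    heat (x + y * delta) (delta ^+ 2) ((\sum_(i <- h) i) / (sigma * Num.sqrt n.+2%:R)))
    + (1 - gauss_cdf y).
  rewrite -[X in _ + X](path_expect_cst m n.+2) -path_expectD.
  by apply: le_path_expect => // h _; exact: indicator_le_heat.
have down : path_expect m n.+2 (fun h =>
    heat (x + - y * delta) (delta ^+ 2) ((\sum_(i <- h) i) / (sigma * Num.sqrt n.+2%:R)))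
    - gauss_cdf (- y) <= F.
  rewrite -[X in _ + X](path_expect_cst m n.+2) -path_expectD.
  by apply: le_path_expect => // h _; rewrite mulNr; exact: heat_le_indicator.
move: h1 h2 h3 h4; rewrite !ler_norml => /andP[a1 a2] /andP[b1 b2] /andP[c1 c2] /andP[g1 g2].
apply/andP; split; lra.
Qed.

Lemma walk_clt : cvg_in_distribution P (normalized_walk X sigma) (normal_prob 0 1).
Proof.
move=> x _.
suff : cdf (normalized_walk X sigma n : {RV P >-> R}) x @[n --> \oo]
    --> (gauss_cdf x)%:E by rewrite -gauss_cdfE.
rewrite (_ : (fun n => cdf _ _) = EFin \o (path_cdf ^~ x)); last first.
  by apply/funext => n; rewrite cdf_normalized_walk.
by apply: cvg_EFin; [exact: nearW|exact: path_cdf_cvg].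
Qed.

End central_limit.

Theorem theorem9p1 (R : realType) (d : measure_display) (T : measurableType d)
    (P : probability T R) (p sigma2 : R)
    (X : nat -> {RV P >-> R}) (K : nat -> {RV P >-> nat})
    (eps : nat -> {RV P >-> R})
    (p_gt0 : 0 < p) (p_lt1 : p < 1)
    (X_walk : elephant_two_recent P p X K eps)
    (X1_pos : P [set w | X 1%N w = 1] = p%:E)
    (X1_neg : P [set w | X 1%N w = -1] = (1 - p)%:E)
    (sigma2_gt0 : 0 < sigma2)
    (sigma2E : sigma2 ^+ 2 =
       1 + (2 * p - 1) * (5 - 2 * p) / (2 * (1 - p) * (3 - 2 * p))) :
  {ae P, forall w, walk X n w / n%:R @[n --> \oo] --> (0 : R)} /\
  cvg_in_distribution P (normalized_walk X sigma2) (normal_prob 0 1).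
Proof.
split; first exact: (walk_strong_law p_gt0 p_lt1 X_walk X1_pos X1_neg).
exact: (walk_clt p_gt0 p_lt1 X_walk X1_pos X1_neg sigma2_gt0 sigma2E).
Qed.
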